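(* Let $\phi$ be an $\mathbf{MT_0}$-formula. The following are equivalent: (a) $\phi$ is flat; (b) $\phi\equiv\alpha$ for some classical formula $\alpha$; (c) $\neg\neg\phi\equiv\phi$; (d) $\models\phi\otimes\neg\phi$.
   Context: **Language of $\mathbf{MT_0}$.** Fix a set $\mathrm{Prop}$ of propositional variables. Classical formulas: $\alpha::=p\mid\bot\mid\alpha\wedge\alpha\mid\alpha\otimes\alpha\mid\alpha\to\alpha\mid\Box\alpha\mid\Diamond\alpha$. Formulas: $\phi::=\alpha\mid\; =\!(\alpha_1,\dots,\alpha_n,\beta)\mid\phi\wedge\phi\mid\phi\otimes\phi\mid\phi\vee\phi\mid\phi\to\phi\mid\Box\phi\mid\Diamond\phi$, where $n\ge 0$ and $\alpha,\alpha_i,\beta$ are classical. $\neg\phi$ abbreviates $\phi\to\bot$. **Team semantics.** A Kripke model is $\mathfrak{M}=(W,R,V)$ with $W\neq\emptyset$, $R\subseteq W\times W$, $V:\mathrm{Prop}\to\wp(W)$. A team is any $X\subseteq W$. $R(X)=\{w\in W\mid\exists v\in X,\ vRw\}$, $R(w)=R(\{w\})$; $XRY$ means $Y\subseteq R(X)$ and $Y\cap R(w)\ne\emptyset$ for every $w\in X$. Satisfaction: - $\mathfrak{M},X\models p$ iff $X\subseteq V(p)$; $\mathfrak{M},X\models\bot$ iff $X=\emptyset$. - $\mathfrak{M},X\models\phi\wedge\psi$ iff both hold on $X$; $\mathfrak{M},X\models\phi\vee\psi$ iff $\mathfrak{M},X\models\phi$ or $\mathfrak{M},X\models\psi$. -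 $\mathfrak{M},X\models\phi\otimes\psi$ iff $X=Y\cup Z$ for some $Y,Z\subseteq X$ with $\mathfrak{M},Y\models\phi$, $\mathfrak{M},Z\models\psi$. - $\mathfrak{M},X\models\phi\to\psi$ iff for all $Y\subseteq X$, $\mathfrak{M},Y\models\phi$ implies $\mathfrak{M},Y\models\psi$. - $\mathfrak{M},X\models\Box\phi$ iff $\mathfrak{M},R(X)\models\phi$; $\mathfrak{M},X\models\Diamond\phi$ iff there is $Y\subseteq W$ with $XRY$ and $\mathfrak{M},Y\models\phi$. - $\mathfrak{M},X\models\;=\!(\alpha_1,\dots,\alpha_n,\beta)$ iff for all $w,u\in X$: if ($\mathfrak{M},\{w\}\models\alpha_i\Leftrightarrow\mathfrak{M},\{u\}\models\alpha_i$) for all $1\le i\le n$, then ($\mathfrak{M},\{w\}\models\beta\Leftrightarrow\mathfrak{M},\{u\}\models\beta$). $\models\phi$ means $\mathfrak{M},X\models\phi$ for all models $\mathfrak{M}$ and teams $X$. $\phi\equiv\psi$ means that $\mathfrak{M},X\models\phi\Leftrightarrow\mathfrak{M},X\models\psi$ for all $\mathfrak{M}$ and $X$. $\phi$ is flat if for all $\mathfrak{M}$ and $X$: $\mathfrak{M},X\models\phi$ iff $\mathfrak{M},\{w\}\models\phi$ for all $w\in X$. *)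

(* Defs.v *)
From Stdlib Require List.
From mathcomp Require Import all_boot.
From mathcomp Require Import boolp classical_sets.

Set Implicit Arguments.
Unset Strict Implicit.
Unset Printing Implicit Defensive.

Local Open Scope classical_set_scope.

Inductive cformula (P : Type) : Type :=
| CVar of P
| CBot
| CAnd of cformula P & cformula P
| CTensor of cformula P & cformula P
| CImp of cformula P & cformula P
| CBox of cformula P
| CDia of cformula P.

Arguments CBot {P}.

(* The grammar clause "phi ::= alpha" is replaced by its unfolding (variables
   and bottom), so that each formula has a unique representation; classical
   formulas are included through the coercion [of_cformula] below.
   [Dep [:: a1; ...; an] b] is the dependence atom =(a1, ..., an, b). *)
Inductive formula (P : Type) : Type :=
| Var of P
| Bot
| Dep of seq (cformula P) & cformula P
| And of formula P & formula P
| Tensor of formula P & formula P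
| Or of formula P & formula P
| Imp of formula P & formula P
| Box of formula P
| Dia of formula P.

Arguments Bot {P}.

Definition Neg (P : Type) (phi : formula P) : formula P := Imp phi Bot.

Fixpoint of_cformula (P : Type) (a : cformula P) : formula P :=
  match a with
  | CVar p => Var p
  | CBot => Bot
  | CAnd b c => And (of_cformula b) (of_cformula c)
  | CTensor b c => Tensor (of_cformula b) (of_cformula c)
  | CImp b c => Imp (of_cformula b) (of_cformula c)
  | CBox b => Box (of_cformula b)
  | CDia b => Dia (of_cformula b)
  end.

Coercion of_cformula : cformula >-> formula.

Record model (P : Type) : Type := Model {
  world : Type;
  world_inhabited : inhabited world;
  acc : world -> world -> Prop;
  valuation : P -> set world }.

Arguments valuation {P} m p _.

Definition team (P : Type) (M : model P) : Type := set (world M).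

Definition succ_team (P : Type) (M : model P) (X : team M) : team M :=
  [set w | exists2 v, X v & acc v w].

Definition team_acc (P : Type) (M : model P) (X Y : team M) : Prop :=
  Y `<=` succ_team X /\
  forall w, X w -> (Y `&` succ_team [set w]) !=set0.

(* The semantic clauses, as operations on properties of teams: they are shared
   by [csat] and [sat], which must be separate recursions because the clause for
   dependence atoms evaluates classical formulas. *)
Section TeamClauses.
Variables (P : Type) (M : model P).
Implicit Types (F G : team M -> Prop) (X Y Z : team M).

Definition var_clause (p : P) X : Prop := X `<=` valuation M p.

Definition bot_clause X : Prop := X = set0.

Definition and_clause F G X : Prop := F X /\ G X.

Definition or_clause F G X : Prop := F X \/ G X.

Definition tensor_clause F G X : Prop :=
  exists Y Z, [/\ Y `<=` X, Z `<=` X, X = Y `|` Z, F Y & G Z].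

Definition imp_clause F G X : Prop := forall Y, Y `<=` X -> F Y -> G Y.

Definition box_clause F X : Prop := F (succ_team X).

Definition dia_clause F X : Prop := exists2 Y, team_acc X Y & F Y.

End TeamClauses.

Fixpoint csat (P : Type) (M : model P) (a : cformula P) : team M -> Prop :=
  match a with
  | CVar p => @var_clause P M p
  | CBot => @bot_clause P M
  | CAnd b c => and_clause (csat b) (csat c)
  | CTensor b c => tensor_clause (csat b) (csat c)
  | CImp b c => imp_clause (csat b) (csat c)
  | CBox b => box_clause (csat b)
  | CDia b => dia_clause (csat b)
  end.

Definition dep_clause (P : Type) (M : model P)
    (s : seq (cformula P)) (b : cformula P) (X : team M) : Prop :=
  forall w u : world M, X w -> X u ->
    (forall a, List.In a s ->
      (csat a ([set w] : team M) <-> csat a ([set u] : team M))) ->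
    (csat b ([set w] : team M) <-> csat b ([set u] : team M)).

Fixpoint sat (P : Type) (M : model P) (phi : formula P) : team M -> Prop :=
  match phi with
  | Var p => @var_clause P M p
  | Bot => @bot_clause P M
  | Dep s b => @dep_clause P M s b
  | And f g => and_clause (sat f) (sat g)
  | Tensor f g => tensor_clause (sat f) (sat g)
  | Or f g => or_clause (sat f) (sat g)
  | Imp f g => imp_clause (sat f) (sat g)
  | Box f => box_clause (sat f)
  | Dia f => dia_clause (sat f)
  end.

Lemma sat_of_cformula (P : Type) (M : model P) (a : cformula P) (X : team M) :
  sat (of_cformula a) X = csat a X.
Proof.
suff -> : @sat P M (of_cformula a) = @csat P M a by [].
by elim: a => //= [b -> c ->|b -> c ->|b -> c ->|b ->|b ->].
Qed.

Definition valid (P : Type) (phi : formula P) : Prop :=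
  forall (M : model P) (X : team M), sat phi X.

Definition equivalent (P : Type) (phi psi : formula P) : Prop :=
  forall (M : model P) (X : team M), sat phi X <-> sat psi X.

Definition flat (P : Type) (phi : formula P) : Prop :=
  forall (M : model P) (X : team M),
    sat phi X <-> forall w, X w -> sat phi ([set w] : team M).

(* Main.v *)
From Stdlib Require List.
From mathcomp Require Import all_boot.
From mathcomp Require Import boolp classical_sets.
Require Import Defs.

(** Classical formulas are flat, and every formula is equivalent to a finite
    intuitionistic disjunction of classical ones: all connectives distribute
    over the disjunction, where for an implication with classical antecedent
    this is the flatness of the antecedent, and dependence atoms reduce by
    =(a, s, b) == (a -> =(s, b)) /\ (~a -> =(s, b)) to =(b) == b \/ ~b. Hence
    every formula is downward closed and agrees on singletons with a classical
    formula, obtained by replacing the disjunction by the tensor; if it is flat,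
    it agrees with that formula everywhere.
    Finally, a negation [Neg phi] says that [phi] fails on every singleton, so
    (c) and (d) both express that [phi] is determined by singletons. *)

Set Implicit Arguments.
Unset Strict Implicit.
Unset Printing Implicit Defensive.

Local Open Scope classical_set_scope.

(** * Flatness of the classical connectives *)

Section FlatTeamProperties.
Variables (P : Type) (M : model P).
Implicit Types (F G : team M -> Prop) (X Y : team M).

Definition flat_prop F : Prop :=
  forall X, F X <-> forall w, X w -> F ([set w] : team M).

Lemma flat_prop_sub F X Y : flat_prop F -> Y `<=` X -> F X -> F Y.
Proof. by move=> hF YX /hF FX; apply/hF => w /YX /FX. Qed.

Lemma flat_and F G : flat_prop F -> flat_prop G -> flat_prop (and_clause F G).
Proof.
move=> hF hG X; split=> [[/hF FX /hG GX] w Xw|FGX]; first by split; auto.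
by split; [apply/hF|apply/hG] => w /FGX [].
Qed.

(** The two parts may overlap, so [X] can be split canonically into the points where [F] holds and
    those where [G] holds; flatness lifts both properties to the parts. *)
Lemma flat_tensorE F G X : flat_prop F -> flat_prop G ->
  tensor_clause F G X <->
  forall w, X w -> F ([set w] : team M) \/ G ([set w] : team M).
Proof.
move=> hF hG; split=> [[Y [Z [_ _ -> /hF FY /hG GZ]]] w [/FY|/GZ]|FGX].
- by left.
- by right.
exists (X `&` [set w | F [set w]]), (X `&` [set w | G [set w]]); split.
- exact: subIsetl.
- exact: subIsetl.
- by rewrite -setIUr; apply/esym/setIidPl.
- by apply/hF => w [].
- by apply/hG => w [].
Qed.

Lemma flat_tensor F G :
  flat_prop F -> flat_prop G -> flat_prop (tensor_clause F G).
Proof.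
move=> hF hG X; split=> [/flat_tensorE FGX w Xw|FGX].
  by apply/flat_tensorE => // _ ->; exact: FGX.
by apply/flat_tensorE => // w /FGX /flat_tensorE; apply.
Qed.

Lemma flat_imp F G : flat_prop F -> flat_prop G -> flat_prop (imp_clause F G).
Proof.
move=> hF hG X; split=> [FGX w Xw Y Yw|FGX Y YX /hF FY].
  by apply: FGX => v /Yw ->.
by apply/hG => w Yw; apply: (FGX w (YX _ Yw)) => //; exact: FY.
Qed.

Lemma flat_box F : flat_prop F -> flat_prop (box_clause F).
Proof.
move=> hF X; split=> [FX w Xw|FX].
  by apply: (flat_prop_sub hF) FX => v [_ -> wv]; exists w.
apply/hF => v [w Xw wv]; apply: (flat_prop_sub hF) (FX w Xw).
by move=> _ ->; exists w.
Qed.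

Lemma flat_dia F : flat_prop F -> flat_prop (dia_clause F).
Proof.
move=> hF X; split=> [[Y [YX XY] FY] w Xw|FX].
  exists (Y `&` succ_team [set w]).
    by split=> [v []//|_ ->]; case: (XY w Xw) => v [Yv wv]; exists v.
  by apply: (flat_prop_sub hF) FY; exact: subIsetl.
(* The largest possible witness: all successors of [X] at which [F] holds. *)
exists (succ_team X `&` [set v | F [set v]]); last by apply/hF => v [].
split=> [|w Xw]; first exact: subIsetl.
have [Y [Yw /(_ w erefl) [v [Yv wv]]] /hF FY] := FX w Xw.
exists v; split=> //; split; last exact: FY.
by case: wv => _ -> wv; exists w.
Qed.

Lemma csat_flat (a : cformula P) : flat_prop (csat a).
Proof.
elim: a => [p||b hb c hc|b hb c hc|b hb c hc|b hb|b hb] /=.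
- by move=> X; split=> [Xp w Xw v ->|Xp w Xw]; [exact: Xp|exact: (Xp w Xw)].
- move=> X; split=> [-> //|X0]; apply/seteqP; split=> // w Xw.
  by rewrite -(X0 w Xw).
- exact: flat_and.
- exact: flat_tensor.
- exact: flat_imp.
- exact: flat_box.
- exact: flat_dia.
Qed.

End FlatTeamProperties.

Lemma sat_cformula_flat (P : Type) (M : model P) (a : cformula P) :
  flat_prop (@sat P M a).
Proof.
move=> X; rewrite sat_of_cformula csat_flat.
by split=> aX w /aX; rewrite sat_of_cformula.
Qed.

(** * Disjunctions of classical formulas *)

Section DisjunctiveNormalForm.
Variable P : Type.
Implicit Types (f g h phi : formula P) (a b : cformula P).

(** A binary tree of disjunctions with classical leaves. Allowing equivalence at every node lets
    inductions on the tree proceed without computing a normal form. *)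
Inductive classical_disj phi : Prop :=
| CDisjClassical a of equivalent phi a
| CDisjOr f g of equivalent phi (Or f g) & classical_disj f & classical_disj g.

Lemma classical_disj_sub phi (M : model P) (X Y : team M) :
  classical_disj phi -> Y `<=` X -> sat phi X -> sat phi Y.
Proof.
move=> nphi YX; elim: {phi} nphi => [phi a e|phi f g e _ IHf _ IHg] /e.
  by move=> aX; apply/e; exact: flat_prop_sub (sat_cformula_flat _) YX aX.
by move=> fgX; apply/e; case: fgX => [/IHf|/IHg]; [left|right].
Qed.

Lemma equivalent_trans f g h :
  equivalent f g -> equivalent g h -> equivalent f h.
Proof. by move=> e1 e2 M X; apply: iff_trans (e2 M X). Qed.

Lemma equivalent_satE f g :
  equivalent f g -> forall M : model P, @sat P M f = sat g.
Proof. by move=> e M; apply/funext => X; apply/propext. Qed.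

Lemma classical_disj_equivalent f g :
  equivalent f g -> classical_disj g -> classical_disj f.
Proof.
move=> e []; first by move=> a ga; apply: CDisjClassical (equivalent_trans e ga).
by move=> g1 g2 g12; apply: CDisjOr (equivalent_trans e g12).
Qed.

(** Distribution is demanded only for disjuncts that are themselves [classical_disj]: for [Imp a] it
    relies on their downward closure. *)
Lemma classical_disj_unary (op : formula P -> formula P)
    (cop : cformula P -> cformula P) :
    (forall a, op a = cop a) ->
    (forall f g, equivalent f g -> equivalent (op f) (op g)) ->
    (forall f g, classical_disj f -> classical_disj g ->
       equivalent (op (Or f g)) (Or (op f) (op g))) ->
  forall f, classical_disj f -> classical_disj (op f).
Proof.
move=> opC opE opOr f; elim=> {f} [f a fa|f f1 f2 e n1 IH1 n2 IH2].
  by apply: (@CDisjClassical _ (cop a)); rewrite -opC; exact: opE.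
by apply: CDisjOr IH1 IH2; exact: equivalent_trans (opE _ _ e) (opOr _ _ n1 n2).
Qed.

Lemma classical_disj_binary (op : formula P -> formula P -> formula P)
    (cop : cformula P -> cformula P -> cformula P) :
    (forall a b, op a b = cop a b) ->
    (forall f f' g g', equivalent f f' -> equivalent g g' ->
       equivalent (op f g) (op f' g')) ->
    (forall f g h, equivalent (op (Or f g) h) (Or (op f h) (op g h))) ->
    (forall f g h, equivalent (op f (Or g h)) (Or (op f g) (op f h))) ->
  forall f g, classical_disj f -> classical_disj g -> classical_disj (op f g).
Proof.
move=> opC opE opOrl opOrr f g + ng.
elim=> {f} [f a fa|f f1 f2 e _ IH1 _ IH2].
  (* With a classical left operand, [op a] is a unary operation on the right one. *)
  apply: (@classical_disj_equivalent _ (op a g)); first exact: opE.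
  apply: (@classical_disj_unary (op a) (cop a)) ng => // ? ? ?.
  exact: opE.
by apply: CDisjOr IH1 IH2; apply: equivalent_trans (opOrl _ _ _); exact: opE.
Qed.

(** * Closure under the connectives *)

Lemma classical_disj_and f g :
  classical_disj f -> classical_disj g -> classical_disj (And f g).
Proof.
apply: (@classical_disj_binary (@And P) (@CAnd P)) => // {f g}.
- move=> f f' g g' /equivalent_satE ef /equivalent_satE eg M X.
  by rewrite /= ef eg.
- by move=> f g h M X; rewrite /= /and_clause /or_clause; tauto.
- by move=> f g h M X; rewrite /= /and_clause /or_clause; tauto.
Qed.

Lemma classical_disj_tensor f g :
  classical_disj f -> classical_disj g -> classical_disj (Tensor f g).
Proof.
apply: (@classical_disj_binary (@Tensor P) (@CTensor P)) => // {f g}.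
- move=> f f' g g' /equivalent_satE ef /equivalent_satE eg M X.
  by rewrite /= ef eg.
- move=> f g h M X; split=> [[Y [Z [YX ZX e [fY|gY] hZ]]]|].
  + by left; exists Y, Z.
  + by right; exists Y, Z.
  + by case=> -[Y [Z [YX ZX e fY hZ]]]; exists Y, Z; split=> //; [left|right].
- move=> f g h M X; split=> [[Y [Z [YX ZX e fY [gZ|hZ]]]]|].
  + by left; exists Y, Z.
  + by right; exists Y, Z.
  + by case=> -[Y [Z [YX ZX e fY hZ]]]; exists Y, Z; split=> //; [left|right].
Qed.

Lemma classical_disj_box f : classical_disj f -> classical_disj (Box f).
Proof.
apply: (@classical_disj_unary (@Box P) (@CBox P)) => // {}f g.
by move=> /equivalent_satE e M X; rewrite /= e.
Qed.

Lemma classical_disj_dia f : classical_disj f -> classical_disj (Dia f).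
Proof.
apply: (@classical_disj_unary (@Dia P) (@CDia P)) => // {}f g.
  by move=> /equivalent_satE e M X; rewrite /= e.
move=> _ _ M X; split=> [[Y XY [fY|gY]]|[] [Y XY FY]].
- by left; exists Y.
- by right; exists Y.
- by exists Y => //; left.
- by exists Y => //; right.
Qed.

(* If [Y] refutes [Imp a f] and [Z] refutes [Imp a g], then [Y `|` Z] still
   satisfies [a], which is flat, and refutes [Or f g]. *)
Lemma imp_classical_or a f g : classical_disj f -> classical_disj g ->
  equivalent (Imp a (Or f g)) (Or (Imp a f) (Imp a g)).
Proof.
move=> nf ng M X; split; last first.
  by case=> H Y YX aY; [left|right]; exact: H.
move=> H; apply: contrapT => /not_orP[].
move=> /existsNP[Y /not_implyP[YX /not_implyP[aY nfY]]].
move=> /existsNP[Z /not_implyP[ZX /not_implyP[aZ ngZ]]].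
have aYZ : sat a (Y `|` Z).
  apply/sat_cformula_flat => w [Yw|Zw].
    by move/sat_cformula_flat: aY; apply.
  by move/sat_cformula_flat: aZ; apply.
have YZX : Y `|` Z `<=` X by rewrite subUset.
case: (H _ YZX aYZ) => [fYZ|gYZ].
  by apply: nfY; apply: classical_disj_sub fYZ => //; exact: subsetUl.
by apply: ngZ; apply: classical_disj_sub gYZ => //; exact: subsetUr.
Qed.

Lemma classical_disj_imp f g :
  classical_disj f -> classical_disj g -> classical_disj (Imp f g).
Proof.
move=> + ng; elim=> {f} [f a fa|f f1 f2 e _ IH1 _ IH2].
  apply: (@classical_disj_equivalent _ (Imp a g)).
    by move=> M X; rewrite /= (equivalent_satE fa).
  apply: (@classical_disj_unary (Imp a) (CImp a)) ng => // [h h' eh M X|h h'].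
    by rewrite /= (equivalent_satE eh).
  exact: imp_classical_or.
(* A disjunction in the antecedent turns into a conjunction of implications, so
   [classical_disj_binary] does not apply to [Imp]. *)
apply: classical_disj_equivalent (classical_disj_and IH1 IH2) => M X.
rewrite /= (equivalent_satE e); split=> [H|[H1 H2] Y YX].
  by split=> Y YX fY; apply: H => //; [left|right].
by case; [exact: H1|exact: H2].
Qed.

(** * Dependence atoms *)

Definition cneg a : cformula P := CImp a CBot.

Lemma csat_cneg_set1 a (M : model P) (w : world M) :
  csat (cneg a) ([set w] : team M) <-> ~ csat a ([set w] : team M).
Proof.
split=> [na aw|naw Y Yw aY].
  by have /seteqP[/(_ w erefl)] := na _ (fun _ => id) aw.
apply/seteqP; split=> // v Yv; apply: naw; rewrite -(Yw _ Yv).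
by move/csat_flat: aY; apply.
Qed.

Lemma sat_cformulaE a (M : model P) (X : team M) :
  sat a X <-> forall w, X w -> csat a ([set w] : team M).
Proof. by rewrite sat_of_cformula; exact: csat_flat. Qed.

Lemma sat_cnegE a (M : model P) (X : team M) :
  sat (cneg a) X <-> forall w, X w -> ~ csat a ([set w] : team M).
Proof.
split=> [/(sat_cformulaE (cneg a)) H w /H /csat_cneg_set1 //|H].
by apply/(sat_cformulaE (cneg a)) => w /H /csat_cneg_set1.
Qed.

(** With no determining formulas, the atom says that the truth value of [b] is constant on the
    team. *)
Lemma dep_nil_equivalent b : equivalent (Dep [::] b) (Or b (cneg b)).
Proof.
move=> M X; split=> [bX|[/sat_cformulaE bX|/sat_cnegE bX] w u Xw Xu _].
- have [[w [Xw bw]]|nb] := pselect (exists w, X w /\ csat b [set w]).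
    by left; apply/sat_cformulaE => u Xu; apply/(bX w u Xw Xu).
  by right; apply/sat_cnegE => w Xw bw; apply: nb; exists w.
- by split=> _; exact: bX.
- by split=> [/(bX w Xw)|/(bX u Xu)].
Qed.

Lemma dep_cons_equivalent a s b :
  equivalent (Dep (a :: s) b)
             (And (Imp a (Dep s b)) (Imp (cneg a) (Dep s b))).
Proof.
move=> M X; split=> [H|[H1 H2] w u Xw Xu E].
  split=> Y YX => [/sat_cformulaE|/sat_cnegE] aY w u Yw Yu E;
    (apply: H; [exact: YX|exact: YX|move=> c [<-|]; last exact: E]).
    by split=> _; exact: aY.
  by split=> [/(aY w Yw)|/(aY u Yu)].
have Eau := E a (or_introl erefl).
have Es c (cs : List.In c s) := E c (or_intror cs).
(* As [w] and [u] agree on [a], the pair satisfies [a] or [cneg a], and the matching implication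
   yields the shorter atom on it. *)
have wuX : [set w; u] `<=` X by move=> v [->|->].
have [aw|naw] := pselect (csat a [set w]).
  apply: (H1 _ wuX) Es; [|by left|by right].
  by apply/sat_cformulaE => v [->|->]; last exact/Eau.
apply: (H2 _ wuX) Es; [|by left|by right].
by apply/sat_cnegE => v [->|->] // /Eau.
Qed.

Lemma classical_disj_cformula a : classical_disj a.
Proof. by apply: (@CDisjClassical _ a). Qed.

Lemma classical_disj_dep s b : classical_disj (Dep s b).
Proof.
elim: s => [|a s IH].
  by apply: CDisjOr (dep_nil_equivalent b) _ _; exact: classical_disj_cformula.
apply: classical_disj_equivalent (dep_cons_equivalent a s b) _.
by apply: classical_disj_and; apply: classical_disj_imp IH;
  exact: classical_disj_cformula.
Qed.

Lemma classical_disj_formula phi : classical_disj phi.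
Proof.
elim: phi => [p||s b|f ? g ?|f ? g ?|f nf g ng|f ? g ?|f ?|f ?].
- exact: (classical_disj_cformula (CVar p)).
- exact: (classical_disj_cformula CBot).
- exact: classical_disj_dep.
- exact: classical_disj_and.
- exact: classical_disj_tensor.
- by apply: CDisjOr nf ng.
- exact: classical_disj_imp.
- exact: classical_disj_box.
- exact: classical_disj_dia.
Qed.

(** * Criteria for flatness *)

Lemma sat_sub phi (M : model P) (X Y : team M) :
  Y `<=` X -> sat phi X -> sat phi Y.
Proof. exact: classical_disj_sub (classical_disj_formula phi). Qed.

(** On a singleton, [Or] and the tensor of flat formulas coincide: the only point must lie in one of
    the two parts. *)
Lemma classical_on_singletons phi : exists a, forall (M : model P) (w : world M),
  sat phi ([set w] : team M) <-> sat a ([set w] : team M).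
Proof.
elim: (classical_disj_formula phi) => {phi}.
  by move=> phi a e; exists a => M w; exact: e.
move=> phi f g e _ [a fa] _ [b gb]; exists (CTensor a b) => M w.
apply: iff_trans (e M _) _; apply: iff_trans (iff_sym _); last first.
  apply: flat_tensorE; exact: sat_cformula_flat.
split=> [[/fa aw|/gb bw] _ ->|/(_ w erefl) [/fa|/gb]]; by [left|right].
Qed.

Lemma flat_classicalP phi : flat phi <-> exists a, equivalent phi a.
Proof.
split=> [hphi|[a e] M X].
  have [a ea] := classical_on_singletons phi; exists a => M X.
  split=> [/hphi H|/sat_cformula_flat H].
    by apply/sat_cformula_flat => w /H /ea.
  by apply/hphi => w /H /ea.
apply: iff_trans (e M X) _; apply: iff_trans (sat_cformula_flat _ _) _.
by split=> H w /H /e.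
Qed.

(** By downward closure, a nonempty subteam satisfying [phi] would contain a singleton satisfying
    it. *)
Lemma sat_negE phi (M : model P) (X : team M) :
  sat (Neg phi) X <-> forall w, X w -> ~ sat phi ([set w] : team M).
Proof.
split=> [H w Xw phiw|H Y YX phiY].
  have wX : [set w] `<=` X by move=> _ ->.
  by have /seteqP[/(_ w erefl)] := H _ wX phiw.
apply/seteqP; split=> // w Yw; apply: (H w (YX w Yw)).
by apply: sat_sub phiY => _ ->.
Qed.

Lemma sat_neg_negE phi (M : model P) (X : team M) :
  sat (Neg (Neg phi)) X <-> forall w, X w -> sat phi ([set w] : team M).
Proof.
split=> [/sat_negE H w Xw|H]; last first.
  by apply/sat_negE => w Xw /sat_negE /(_ w erefl); apply; exact: H.
apply: contrapT => nphi; apply: (H w Xw).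
by apply/sat_negE => _ ->.
Qed.

Lemma flat_neg_negP phi : flat phi <-> equivalent (Neg (Neg phi)) phi.
Proof.
split=> H M X; first exact: iff_trans (sat_neg_negE phi X) (iff_sym (H M X)).
exact: iff_trans (iff_sym (H M X)) (sat_neg_negE phi X).
Qed.

Lemma flat_excluded_middleP phi : flat phi <-> valid (Tensor phi (Neg phi)).
Proof.
split=> [hphi M X|H M X].
  exists (X `&` [set w | sat phi [set w]]), (X `&` ~` [set w | sat phi [set w]]).
  split; [exact: subIsetl|exact: subIsetl|by rewrite -setIUr setUv setIT| |].
    by apply/hphi => w [].
  by apply/sat_negE => w [].
split=> [phiX w Xw|phiX]; first by apply: sat_sub phiX => _ ->.
(* [phi] fails at each point of [Z] but holds at each point of [X], so [Z] is empty and [X] is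
   [Y]. *)
have [Y [Z [_ ZX -> phiY /sat_negE nphiZ]]] := H M X.
have -> : Z = set0 by apply/seteqP; split=> // w Zw; apply: (nphiZ w Zw); auto.
by rewrite setU0.
Qed.

End DisjunctiveNormalForm.

Theorem theorem2p15 (P : Type) (phi : formula P) :
  (flat phi <-> exists alpha : cformula P, equivalent phi (of_cformula alpha)) /\
  ((exists alpha : cformula P, equivalent phi (of_cformula alpha)) <->
     equivalent (Neg (Neg phi)) phi) /\
  (equivalent (Neg (Neg phi)) phi <-> valid (Tensor phi (Neg phi))).
Proof.
have ab := flat_classicalP phi.
have ac := flat_neg_negP phi.
have ad := flat_excluded_middleP phi.
by tauto.
Qed.
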